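(* Let $\mathcal{G}=(\mathcal{V},\mathcal{E},\mathbf{W})$ be a connected signed weighted undirected graph with Laplacian $L$. If $L$ is positive semi-definite with only one zero eigenvalue, then for any two non-empty disjoint sets $\mathcal{V}_a,\mathcal{V}_b\subset\mathcal{V}$, $g_{\mathrm{eff}}(L,\mathcal{V}_a,\mathcal{V}_b)$ is non-decreasing and $r_{\mathrm{eff}}(L,\mathcal{V}_a,\mathcal{V}_b)$ is non-increasing after adding an edge $(i,j)$ with weight $\Delta w_{ij}>0$ to the graph $\mathcal{G}$. That is, for any $i\ne j$ in $\mathcal{V}$ and $\Delta w_{ij}>0$, with $L'=L+\Delta w_{ij}(\mathbf{e}_i-\mathbf{e}_j)(\mathbf{e}_i-\mathbf{e}_j)^T$, one has $g_{\mathrm{eff}}(L',\mathcal{V}_a,\mathcal{V}_b)\ge g_{\mathrm{eff}}(L,\mathcal{V}_a,\mathcal{V}_b)$ and $r_{\mathrm{eff}}(L',\mathcal{V}_a,\mathcal{V}_b)\le r_{\mathrm{eff}}(L,\mathcal{V}_a,\mathcal{V}_b)$.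
   Context: Graph: $\mathcal{G}=(\mathcal{V},\mathcal{E},\mathbf{W})$ is a simple undirected connected graph with finite node set $\mathcal{V}$, $n=|\mathcal{V}|$, edge set $\mathcal{E}$, $l=|\mathcal{E}|$; each edge $(i,j)$ carries a nonzero real weight $w_{ij}$, positive or negative, and $\mathbf{W}\in\mathbb{R}^{l\times l}$ is the diagonal matrix of edge weights. With the edges arbitrarily oriented, $\mathbf{E}\in\mathbb{R}^{n\times l}$ is the incidence matrix (column of an edge from $i$ to $j$: entry $1$ in row $i$, $-1$ in row $j$, $0$ elsewhere). The Laplacian is $L=\mathbf{E}\mathbf{W}\mathbf{E}^T$ (real symmetric with zero row sums). ''Positive semi-definite with only one zero eigenvalue'' means $L\succeq 0$ and $0$ is a simple eigenvalue. $\mathbf{e}_i\in\mathbb{R}^n$ is the $i$-th standard basis vector. Adding an edge $(i,j)$ of weight $\Delta w_{ij}$ (in parallel, if $(i,j)$ is already an edge) changes the Laplacian from $L$ to $L+\Delta w_{ij}(\mathbf{e}_i-\mathbf{e}_j)(\mathbf{e}_i-\mathbf{e}_j)^T$. Effective resistance/conductance: for non-empty disjoint $\mathcal{V}_a,\mathcal{V}_b\subset\mathcal{V}$ put $\mathcal{V}_c=\mathcal{V}\setminus(\mathcal{V}_a\cup\mathcal{V}_b)$, $a=|\mathcal{V}_a|$, $b=|\mathcal{V}_b|$, and let $L_{xy}$ be the submatrix of $L$ with rows indexed by $\mathcal{V}_x$ and columns by $\mathcal{V}_y$. When $L_{cc}$ is nonsingular (which is automatic if $L$ is positive semi-definite with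 only one zero eigenvalue), let $L/L_{cc}$ be the Schur complement $$L/L_{cc}=\begin{bmatrix}L_{aa}&L_{ab}\\L_{ab}^T&L_{bb}\end{bmatrix}-\begin{bmatrix}L_{ac}\\L_{bc}\end{bmatrix}L_{cc}^{-1}\begin{bmatrix}L_{ac}^T&L_{bc}^T\end{bmatrix},$$ with $L/L_{cc}=L$ if $\mathcal{V}_c=\emptyset$. Then $g_{\mathrm{eff}}(L,\mathcal{V}_a,\mathcal{V}_b)=\mathbf{e}_{\mathcal{V}_a}^T(L/L_{cc})\mathbf{e}_{\mathcal{V}_a}$, where $\mathbf{e}_{\mathcal{V}_a}\in\mathbb{R}^{a+b}$ has entries $1$ on $\mathcal{V}_a$ and $0$ on $\mathcal{V}_b$, and $r_{\mathrm{eff}}(L,\mathcal{V}_a,\mathcal{V}_b)=g_{\mathrm{eff}}(L,\mathcal{V}_a,\mathcal{V}_b)^{-1}$ (with $r_{\mathrm{eff}}=\infty$ if $g_{\mathrm{eff}}=0$). The same definitions apply to $L'$. *)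

(* Defs.v *)
From HB Require Import structures.
From mathcomp Require Import all_boot all_order all_algebra.
From mathcomp Require Import reals constructive_ereal.

Set Implicit Arguments.
Unset Strict Implicit.
Unset Printing Implicit Defensive.

Import Order.TTheory GRing.Theory Num.Theory.
Local Open Scope ring_scope.

(* A simple undirected graph on the nodes 'I_n with nonzero real edge weights
   of either sign. The orientation (edge_tail e, edge_head e) of an edge is arbitrary and
   only serves to write the incidence matrix; edges are compared as unordered
   pairs, so there are no loops and no parallel edges. *)
Record signed_graph (R : realType) (n : nat) := SignedGraph {
  nb_edges : nat;
  edge_tail : 'I_nb_edges -> 'I_n;
  edge_head : 'I_nb_edges -> 'I_n;
  weight : 'I_nb_edges -> R;
  no_loop : forall e, edge_tail e != edge_head e;
  no_parallel : injective (fun e => [set edge_tail e; edge_head e]);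
  weight_neq0 : forall e, weight e != 0
}.

Section Graph.
Context {R : realType} {n : nat} (G : signed_graph R n).

Definition adjacent : rel 'I_n :=
  fun u v => [exists e : 'I_(nb_edges G), [set u; v] == [set edge_tail e; edge_head e]].

Definition connected : Prop := forall u v : 'I_n, connect adjacent u v.

Definition incidence : 'M[R]_(n, nb_edges G) :=
  \matrix_(v, e) ((v == edge_tail e)%:R - (v == edge_head e)%:R).

Definition weight_mx : 'M[R]_(nb_edges G) := diag_mx (\row_e weight e).

Definition laplacian : 'M[R]_n := incidence *m weight_mx *m incidence^T.

End Graph.

Section Matrices.
Context {R : realType} {n : nat}.

Definition psd (A : 'M[R]_n) : Prop :=
  A^T = A /\ forall x : 'cV[R]_n, 0 <= (x^T *m A *m x) 0 0.

(* The zero eigenvalue is counted with its algebraic multiplicity. *)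
Definition psd_one_zero_eigenvalue (A : 'M[R]_n) : Prop :=
  psd A /\ mup 0 (char_poly A) = 1%N.

Definition basis_vec (i : 'I_n) : 'cV[R]_n := delta_mx i 0.

Definition add_edge (L : 'M[R]_n) (i j : 'I_n) (dw : R) : 'M[R]_n :=
  L + dw *: ((basis_vec i - basis_vec j) *m (basis_vec i - basis_vec j)^T).

Definition submx_on (L : 'M[R]_n) (X Y : {set 'I_n}) : 'M[R]_(#|X|, #|Y|) :=
  mxsub (fun k : 'I_#|X| => enum_val k) (fun k : 'I_#|Y| => enum_val k) L.

(* The Schur complement L / L_cc with Vc the complement of Va :|: Vb, rows and
   columns being listed with those of Va first. It is meaningful only when L_cc
   is invertible, since invmx is the identity on singular matrices. If Vc is
   empty the subtracted term is an empty sum, leaving L itself. *)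
Definition schur (L : 'M[R]_n) (Va Vb : {set 'I_n}) : 'M[R]_(#|Va| + #|Vb|) :=
  let Vc := ~: (Va :|: Vb) in
  let Lac := submx_on L Va Vc in
  let Lbc := submx_on L Vb Vc in
  block_mx (submx_on L Va Va) (submx_on L Va Vb)
           (submx_on L Va Vb)^T (submx_on L Vb Vb)
  - col_mx Lac Lbc *m invmx (submx_on L Vc Vc) *m row_mx Lac^T Lbc^T.

Definition indicator_a (a b : nat) : 'cV[R]_(a + b) :=
  col_mx (const_mx 1) (const_mx 0).

Definition g_eff (L : 'M[R]_n) (Va Vb : {set 'I_n}) : R :=
  ((indicator_a #|Va| #|Vb|)^T *m schur L Va Vb *m indicator_a #|Va| #|Vb|) 0 0.

Definition r_eff (L : 'M[R]_n) (Va Vb : {set 'I_n}) : \bar R :=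
  if g_eff L Va Vb == 0 then +oo%E else ((g_eff L Va Vb)^-1)%:E.

End Matrices.

(* Main.v *)
Require Import Defs.
From mathcomp Require Import all_boot all_order all_algebra.
From mathcomp Require Import reals constructive_ereal.
From mathcomp Require Import lra.

Import Order.TTheory GRing.Theory Num.Theory.
Local Open Scope ring_scope.

(** The reason is Dirichlet's principle. Call [energy L x] the quadratic form
    [x^T L x] of a vector of potentials [x]. Completing the square in the
    potentials of the nodes outside [Va] and [Vb] shows that [g_eff L Va Vb] is
    the minimum of [energy L x] over all [x] equal to 1 on [Va] and to 0 on [Vb]
    ([g_eff_le_energy], [g_eff_attained]). An edge of weight [dw > 0] adds
    [dw * (x i - x j)^2] to the energy of every [x], hence cannot lower the
    minimum ([g_eff_mono]). Conductances are nonnegative, being energies, so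
    their inverses are ordered the other way round ([r_eff_anti]).

    The minimum is given by the Schur complement only if the interior block
    [L_cc] is invertible, for the old and for the new Laplacian. An interior
    potential killed by [L_cc] has, once extended by 0, zero energy. As [L] is
    positive semi-definite it lies in the kernel of [L], which is the line of
    constant vectors: 0 is a simple root of the characteristic polynomial, and
    geometric multiplicity is at most algebraic multiplicity
    ([rank_eigenspace_le_mup]). A constant that vanishes on [Va] is 0. Since the
    energies of the new Laplacian dominate the old ones, the same holds for it. *)

(** * Geometric and algebraic multiplicity *)

(** Gaussian elimination writes [A - a] as [C * pid_mx r * D] with [C] and [D]
    invertible and [r] its rank. Up to the constant factors [C] and [D], the
    characteristic matrix is then [('X - a) C^-1 D^-1 - pid_mx r], whose last
    [n - r] rows are divisible by ['X - a]. *)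
Lemma rank_eigenspace_le_mup (F : fieldType) (n : nat) (A : 'M[F]_n) (a : F) :
  (\rank (eigenspace A a) <= mup a (char_poly A))%N.
Proof.
rewrite mup_geq ?monic_neq0 ?char_poly_monic // /eigenspace mxrank_ker.
set B := A - a%:M; set r := \rank B.
pose C := col_ebase B; pose D := row_ebase B.
have uC : C \in unitmx by exact: col_ebase_unit.
have uD : D \in unitmx by exact: row_ebase_unit.
pose T := invmx C *m invmx D.
pose N : 'M[{poly F}]_n := \matrix_(k, l)
  if (k < r)%N then ('X - a%:P) * (T k l)%:P - (pid_mx r k l)%:P
  else (T k l)%:P.
pose d : 'rV[{poly F}]_n := \row_k if (k < r)%N then 1 else 'X - a%:P.
have charE : char_poly_mx A =
    map_mx polyC C *m (diag_mx d *m N) *m map_mx polyC D.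
  have -> : diag_mx d *m N
      = ('X - a%:P) *: map_mx polyC T - map_mx polyC (pid_mx r).
    apply/matrixP=> k l; rewrite mul_diag_mx !mxE; case: ltnP => kr.
      by rewrite mul1r.
    by rewrite andbF polyC0 subr0.
  rewrite mulmxBr mulmxBl -scalemxAr -scalemxAl -!map_mxM /=.
  rewrite mulmxA mulmxKV // mulmxV // mulmx_ebase /B.
  rewrite map_mx1 map_mxB map_scalar_mx /= /char_poly_mx scalemx1.
  by rewrite raddfB /= opprB addrA subrK.
rewrite /char_poly charE !det_mulmx det_diag.
apply: dvdp_mulr; apply: dvdp_mull; apply: dvdp_mulr.
have -> : \prod_k d 0 k = ('X - a%:P) ^+ (n - r).
  rewrite (eq_bigr (fun k : 'I_n => if ~~ (k < r)%N then 'X - a%:P else 1)).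
    rewrite -big_mkcond /= prodr_const; congr (_ ^+ _).
    have rn : (r <= n)%N by exact: rank_leq_row.
    rewrite -[n in RHS]card_ord -(cardC (fun k : 'I_n => (k < r)%N)).
    have -> : #|(fun k : 'I_n => (k < r)%N)| = r.
      by rewrite -sum1_card (big_ord_narrow rn) /= sum1_card card_ord.
    by rewrite addKn; apply: eq_card.
  by move=> k _; rewrite mxE; case: (k < r)%N.
exact: dvdpp.
Qed.

(** * Quadratic forms of symmetric matrices *)

Section QuadraticForms.
Context {R : realType}.

Definition energy {n : nat} (A : 'M[R]_n) (x : 'cV[R]_n) : R :=
  (x^T *m A *m x) 0 0.

(** With [y = A x], the energy of [x + t y] is [2 t |y|^2 + t^2 energy A y], which
    takes negative values for small negative [t] unless [y = 0]. *)
Lemma psd_energy0_ker (n : nat) (A : 'M[R]_n) (x : 'cV[R]_n) :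
  psd A -> energy A x = 0 -> A *m x = 0.
Proof.
move=> [symA posA] x0.
set y := A *m x.
have yE : y^T = x^T *m A by rewrite trmx_mul symA.
pose s := energy A y; pose q := (y^T *m y) 0 0.
have s_ge0 : 0 <= s by exact: posA.
have q_ge0 : 0 <= q.
  by rewrite /q mxE sumr_ge0 // => k _; rewrite mxE -expr2 sqr_ge0.
have expand t : energy A (x + t *: y) = 2 * t * q + t ^+ 2 * s.
  rewrite /energy (linearD (@trmx R _ _)) (linearZ_LR (@trmx R _ _)) /=.
  rewrite !mulmxDl !mulmxDr -!scalemxAl -!scalemxAr.
  rewrite -yE -(mulmxA _ A x) -/y !mxE.
  move: x0; rewrite /energy -yE /s /energy !mxE /q !mxE => ->.
  by lra.
have q0 : q = 0.
  apply/eqP; rewrite eq_le q_ge0 andbT leNgt; apply/negP=> q_gt0.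
  (* The minimizer would be - q / s, but s may vanish; dividing by s + 1
     instead still makes the linear term win. *)
  have := posA (x + (- (q / (s + 1))) *: y).
  rewrite -/(energy _ _) expand.
  set t := q / (s + 1).
  have t_gt0 : 0 < t by rewrite divr_gt0 // ltr_wpDl.
  have ts : t * s = q - t.
    have : t * (s + 1) = q by rewrite divfK // gt_eqF // ltr_wpDl.
    by lra.
  have -> : 2 * - t * q + (- t) ^+ 2 * s = - (t * (q + t)).
    by rewrite sqrrN expr2 -[t * t * s]mulrA ts; lra.
  by rewrite oppr_ge0 leNgt mulr_gt0 // addr_gt0.
apply/matrixP=> k l; rewrite (ord1 l) [RHS]mxE.
move/eqP: q0; rewrite /q mxE psumr_eq0 => [/allP /(_ k)|k' _].
  by rewrite mem_index_enum mxE mulf_eq0 orbb => /(_ isT) /eqP.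
by rewrite mxE -expr2 sqr_ge0.
Qed.

(** The formula behind Schur complements: the part of the right-hand side that
    does not depend on [y] is the quadratic form at [u] of the Schur complement,
    and the rest is the quadratic form of [S^T L S] centred at the critical point
    [- (S^T L S)^-1 S^T L u]. *)
Lemma energy_complete_square {n m : nat} {L : 'M[R]_n} (S : 'M[R]_(n, m))
    (u : 'cV[R]_n) (y : 'cV[R]_m) :
    L^T = L -> S^T *m L *m S \in unitmx ->
  let A := S^T *m L *m S in
  let b := S^T *m L *m u in
  energy L (u + S *m y)
    = energy L u - (b^T *m invmx A *m b) 0 0 + energy A (y + invmx A *m b).
Proof.
move=> symL uA A b.
have symA : A^T = A by rewrite /A !trmx_mul trmxK symL mulmxA.
have bE : b^T = u^T *m L *m S by rewrite /b !trmx_mul trmxK symL mulmxA.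
have expandA : (y + invmx A *m b)^T *m A *m (y + invmx A *m b)
    = y^T *m A *m y + y^T *m b + b^T *m y + b^T *m invmx A *m b.
  move: uA symA {bE}; rewrite -/A; move: A b => A b uA symA.
  rewrite (linearD (@trmx R _ _)) /= trmx_mul trmx_inv symA !mulmxDl !mulmxDr.
  by rewrite !mulmxA (mulmxK uA) (mulmxKV uA) addrA.
have expandL : (u + S *m y)^T *m L *m (u + S *m y)
    = u^T *m L *m u + y^T *m b + b^T *m y + y^T *m A *m y.
  rewrite (linearD (@trmx R _ _)) /= trmx_mul !mulmxDl !mulmxDr.
  rewrite bE /A /b !mulmxA addrA.
  by congr (_ + _); rewrite -!addrA; congr (_ + _); rewrite addrC.
by rewrite /energy expandA expandL !mxE; lra.
Qed.

End QuadraticForms.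

(** * Effective conductance as a minimal energy *)

Section EffectiveConductance.
Context {R : realType} {n : nat}.
Implicit Types (L : 'M[R]_n) (X Y Va Vb : {set 'I_n}).

(** Inclusion matrix: multiplying by it extends a vector on [X] by 0 to all nodes;
    multiplying by its transpose restricts a vector to [X]. Written with it,
    submatrices become products, so that no block decomposition of ['I_n] is
    needed. *)
Definition extend0 X : 'M[R]_(n, #|X|) :=
  colsub (fun k : 'I_#|X| => enum_val k) 1%:M.

Lemma submx_onE L X Y : submx_on L X Y = (extend0 X)^T *m L *m extend0 Y.
Proof.
rewrite /extend0 trmx_mxsub trmx1 mul_rowsub_mx mul1mx mulmx_colsub mulmx1.
by apply/matrixP=> k l; rewrite !mxE.
Qed.

Lemma extend0K X (y : 'cV[R]_#|X|) : (extend0 X)^T *m (extend0 X *m y) = y.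
Proof.
rewrite /extend0 trmx_mxsub trmx1 mul_rowsub_mx mul1mx.
apply/matrixP=> k l; rewrite mxE mxE (bigD1 k) //= !mxE eqxx mul1r big1 ?addr0 //.
move=> k' /negPf k'k; rewrite !mxE (inj_eq enum_val_inj) eq_sym k'k mul0r //.
Qed.

Lemma extend0_out X (y : 'cV[R]_#|X|) v l :
  v \notin X -> (extend0 X *m y) v l = 0.
Proof.
move=> vX; rewrite mxE big1 // => k _; rewrite !mxE.
case: eqP => [vk|_]; last by rewrite mul0r.
by rewrite vk enum_valP in vX.
Qed.

Definition potential Va : 'cV[R]_n := extend0 Va *m const_mx 1.

(** Evaluating the Schur complement at the indicator of [Va] turns it into the
    constant term of [energy_complete_square], for [S] the inclusion of the
    interior nodes and [u] the potential equal to 1 on [Va] and 0 elsewhere. *)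
Lemma g_effE L Va Vb : L^T = L ->
  let S := extend0 (~: (Va :|: Vb)) in
  let b := S^T *m L *m potential Va in
  g_eff L Va Vb
    = energy L (potential Va) - (b^T *m invmx (S^T *m L *m S) *m b) 0 0.
Proof.
move=> symL S b.
rewrite /g_eff /schur /indicator_a tr_col_mx !trmx_const mulmxBr mulmxBl.
rewrite mxE [X in _ + X]mxE; congr (_ - _).
  rewrite mul_row_block mul_row_col !mul0mx !addr0 mulmx0 addr0 submx_onE.
  by rewrite /energy /potential trmx_mul trmx_const !mulmxA.
rewrite !mulmxA mul_row_col mul0mx addr0 -!mulmxA mul_row_col mulmx0 addr0.
rewrite !submx_onE -/S /b /potential.
by rewrite !trmx_mul !trmxK symL trmx_const !mulmxA.
Qed.

(** For a positive semi-definite [L] this says that the block of [L] on the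
    complement of [V] is positive definite. Stating it for vectors on all nodes
    makes it pass from [L] to any [L'] with larger energies. *)
Definition positive_off L (V : {set 'I_n}) : Prop :=
  forall x : 'cV[R]_n,
    (forall v, v \in V -> x v 0 = 0) -> energy L x = 0 -> x = 0.

(** A vector killed by the interior block has zero energy after extension by 0. *)
Lemma unitmx_interior L V : positive_off L V ->
  (extend0 (~: V))^T *m L *m extend0 (~: V) \in unitmx.
Proof.
move=> posL; set S := extend0 _; rewrite -unitmx_tr -row_free_unit -kermx_eq0.
apply/eqP/row_matrixP=> k; rewrite row0.
set w := row k _.
have w0 : (S^T *m L *m S) *m w^T = 0.
  by apply: trmx_inj; rewrite trmx_mul trmxK trmx0; apply/sub_kermxP/row_sub.
have Sw0 : S *m w^T = 0.
  apply: posL => [v vV|]; first by rewrite extend0_out // inE vV.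
  have -> : energy L (S *m w^T) = (w *m (S^T *m L *m S *m w^T)) 0 0.
    by rewrite /energy trmx_mul trmxK !mulmxA.
  by rewrite w0 mulmx0 mxE.
by apply: trmx_inj; rewrite -[w^T](@extend0K (~: V)) -/S Sw0 mulmx0 trmx0.
Qed.

Lemma g_eff_le_energy L Va Vb (y : 'cV[R]_#|~: (Va :|: Vb)|) :
    psd L -> positive_off L (Va :|: Vb) ->
  g_eff L Va Vb <= energy L (potential Va + extend0 _ *m y).
Proof.
move=> [symL psdL] posL; rewrite g_effE //.
rewrite (energy_complete_square _ _ _ symL) ?unitmx_interior // lerDl.
set S := extend0 _; set z := (_ + _).
have -> : energy (S^T *m L *m S) z = energy L (S *m z).
  by rewrite /energy trmx_mul !mulmxA.
exact: psdL.
Qed.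

Lemma g_eff_attained L Va Vb : L^T = L -> positive_off L (Va :|: Vb) ->
  exists y, g_eff L Va Vb = energy L (potential Va + extend0 (~: (Va :|: Vb)) *m y).
Proof.
move=> symL posL; set S := extend0 _.
exists (- (invmx (S^T *m L *m S) *m (S^T *m L *m potential Va))).
rewrite g_effE // (energy_complete_square _ _ _ symL) ?unitmx_interior //.
have energy0 : energy (S^T *m L *m S) 0 = 0 by rewrite /energy mulmx0 mxE.
by rewrite addNr energy0 addr0.
Qed.

(** The two minima are compared at the minimizer for [L']: its [L]-energy is at
    least the minimum for [L], and at most its [L']-energy. *)
Lemma g_eff_mono L L' Va Vb : psd L -> L'^T = L' ->
    (forall x, energy L x <= energy L' x) -> positive_off L (Va :|: Vb) ->
  g_eff L Va Vb <= g_eff L' Va Vb.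
Proof.
move=> psdL symL' leL posL.
have posL' : positive_off L' (Va :|: Vb).
  move=> x xV x0; apply: posL => //.
  by apply/eqP; rewrite eq_le [0 <= _](psdL.2 x) andbT -x0 leL.
have [y ->] := g_eff_attained _ _ _ symL' posL'.
exact: le_trans (g_eff_le_energy _ _ _ y psdL posL) (leL _).
Qed.

Lemma g_eff_ge0 L Va Vb : psd L -> positive_off L (Va :|: Vb) ->
  0 <= g_eff L Va Vb.
Proof.
by move=> psdL /(g_eff_attained _ _ _ psdL.1) [y ->]; exact: psdL.2.
Qed.

(** Only an infinite resistance for [L] needs care: it is an upper bound of
    everything. Otherwise both conductances are positive reals. *)
Lemma r_eff_anti L L' Va Vb : 0 <= g_eff L Va Vb ->
    g_eff L Va Vb <= g_eff L' Va Vb ->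
  (r_eff L' Va Vb <= r_eff L Va Vb)%E.
Proof.
move=> g_ge0 gg'; rewrite /r_eff.
have [_|g_neq0] := eqVneq (g_eff L Va Vb) 0; first exact: leey.
have g_gt0 : 0 < g_eff L Va Vb by rewrite lt_neqAle eq_sym g_neq0.
have g'_gt0 := lt_le_trans g_gt0 gg'.
by rewrite gt_eqF // lee_fin lef_pV2.
Qed.

Lemma energy_add_edge L i j dw x :
  energy (add_edge L i j dw) x = energy L x + dw * (x i 0 - x j 0) ^+ 2.
Proof.
rewrite /energy /add_edge; set c := _ - _.
have cx : c^T *m x = (x i 0 - x j 0)%:M.
  rewrite /c /basis_vec (linearB (@trmx R _ _)) /= !trmx_delta mulmxBl -!rowE.
  by apply/matrixP=> k l; rewrite !ord1 !mxE.
have xc : x^T *m c = (x i 0 - x j 0)%:M.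
  by apply: trmx_inj; rewrite trmx_mul trmxK cx tr_scalar_mx.
rewrite mulmxDr mulmxDl -scalemxAr -scalemxAl !mulmxA xc -[_%:M *m _ *m _]mulmxA cx.
by rewrite -scalar_mxM !mxE expr2.
Qed.

Lemma trmx_add_edge L i j dw : L^T = L -> (add_edge L i j dw)^T = add_edge L i j dw.
Proof.
by move=> symL; rewrite /add_edge linearD linearZ /= trmx_mul trmxK symL.
Qed.

End EffectiveConductance.

(** * The Laplacian *)

Lemma laplacian_const (R : realType) (n : nat) (G : signed_graph R n) :
  laplacian G *m const_mx 1 = 0 :> 'cV[R]_n.
Proof.
rewrite /laplacian -mulmxA; suff -> : (incidence G)^T *m const_mx 1 = 0 :> 'cV[R]__.
  by rewrite mulmx0.
apply/matrixP=> e l; rewrite !mxE.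
under eq_bigr do rewrite !mxE mulr1.
rewrite sumrB; have sum_delta (w : 'I_n) : \sum_v (v == w)%:R = 1 :> R.
  by rewrite (bigD1 w) //= eqxx big1 ?addr0 // => v /negPf ->.
by rewrite !sum_delta subrr.
Qed.

(** The kernel has dimension at most 1 and contains the constants, hence consists
    of them; a constant that vanishes at one node is 0. *)
Lemma positive_off_one_zero (R : realType) (n : nat) (L : 'M[R]_n)
    (V : {set 'I_n}) :
    L *m const_mx 1 = 0 :> 'cV[R]_n -> psd_one_zero_eigenvalue L -> V != set0 ->
  positive_off L V.
Proof.
move=> L1 [psdL mupL] /set0Pn [v vV] x xV /(psd_energy0_ker _ _ _ psdL) Lx.
have ker_row (z : 'cV[R]_n) : L *m z = 0 -> (z^T <= eigenspace L 0)%MS.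
  by move=> Lz; apply/eigenspaceP;
    rewrite -[L in LHS]psdL.1 -trmx_mul Lz scale0r trmx0.
pose o : 'cV[R]_n := const_mx 1.
have o_neq0 : o^T != 0.
  apply/eqP=> /matrixP /(_ 0 v) /eqP; rewrite !mxE; exact/negP/oner_neq0.
have rank_o : \rank o^T = 1%N by rewrite rank_rV o_neq0.
have ker_o : (eigenspace L 0 <= o^T)%MS.
  rewrite -(geq_leqif (mxrank_leqif_sup (ker_row o L1))) rank_o -mupL.
  exact: rank_eigenspace_le_mup.
have /sub_rVP [a xE] := submx_trans (ker_row x Lx) ker_o.
have a0 : a = 0.
  by move/matrixP/(_ 0 v): xE; rewrite !mxE xV // mulr1.
by apply: trmx_inj; rewrite xE a0 scale0r trmx0.
Qed.

Theorem theorem4 (R : realType) (n : nat) (G : signed_graph R n)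
    (G_connected : connected G)
    (L_psd : psd_one_zero_eigenvalue (laplacian G))
    (Va Vb : {set 'I_n}) (Va_neq0 : Va != set0) (Vb_neq0 : Vb != set0)
    (Vab_disjoint : [disjoint Va & Vb])
    (i j : 'I_n) (i_neq_j : i != j) (dw : R) (dw_gt0 : 0 < dw) :
  let L := laplacian G in
  let L' := add_edge L i j dw in
  (g_eff L' Va Vb >= g_eff L Va Vb) /\
  (r_eff L' Va Vb <= r_eff L Va Vb)%E.
Proof.
move=> L L'.
have V_neq0 : Va :|: Vb != set0 by rewrite setU_eq0 negb_and Va_neq0.
have posL := positive_off_one_zero _ _ _ _ (laplacian_const _ _ G) L_psd V_neq0.
have psdL := L_psd.1.
have g_le : g_eff L Va Vb <= g_eff L' Va Vb.
  apply: g_eff_mono => // [|x]; first exact/trmx_add_edge/psdL.1.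
  by rewrite energy_add_edge lerDl mulr_ge0 ?sqr_ge0 // ltW.
split=> //; exact: r_eff_anti (g_eff_ge0 _ _ _ psdL posL) g_le.
Qed.
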